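(* Let $d\geq 1$ and let $f_0,f_1$ be smooth vector fields on $\mathbb{R}^d$. If there exists an $(\mathbb{R}^+,\mathbb{R})$ splitting method of order $3$ relative to $(f_0,f_1)$, then the vector fields $f_{W_1}=[f_1,[f_1,f_0]]$ and $f_{M_2}=[[f_1,f_0],f_0]$ are linearly dependent (over $\mathbb{R}$).
   Context: $\mathbb{R}^+=[0,\infty)$. The Lie bracket of smooth vector fields is $[f,g](x)=Dg(x)f(x)-Df(x)g(x)$. For a vector field $g$, $e^{g}$ denotes the time-one flow of $\dot x=g(x)$; products of flows are compositions of maps (rightmost applied first). An $(\mathbb{R}^+,\mathbb{R})$ splitting method consists of $k\geq1$, $(\alpha_1,\dots,\alpha_k)\in(\mathbb{R}^+)^k$ and $(\beta_1,\dots,\beta_k)\in\mathbb{R}^k$, independent of $T$. It is of order $N$ relative to $(f_0,f_1)$ when, for every $x_0\in\mathbb{R}^d$, there exists $C$ such that, for $T>0$ small enough, $$\left| e^{T(f_0+f_1)}x_0 - e^{\alpha_1 T f_0}e^{\beta_1 T f_1}\cdots e^{\alpha_k T f_0}e^{\beta_k T f_1}x_0\right|\leq C\,T^{N+1}.$$ *)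

(* Defs.v *)
From HB Require Import structures.
From mathcomp Require Import all_boot all_order all_algebra.
From mathcomp Require Import all_classical all_reals all_analysis.

Set Implicit Arguments.
Unset Strict Implicit.
Unset Printing Implicit Defensive.

Import Order.TTheory GRing.Theory Num.Theory.
Import numFieldNormedType.Exports.

Local Open Scope classical_set_scope.
Local Open Scope ring_scope.

(* The norm of 'rV[R]_d is the sup norm; all norms of R^d are equivalent, so
   the choice only affects the constant in [splitting_order]. *)
Definition vfield (R : realType) (d : nat) : Type := 'rV[R]_d -> 'rV[R]_d.

(* C^oo: in finite dimension, all the maps x |-> D^n f(x)(v_1, ..., v_n) being
   Frechet differentiable for all n and all fixed v_1, ..., v_n. *)
Definition smooth (R : realType) (d : nat) (f : vfield R d) : Prop :=
  forall (vs : seq 'rV[R]_d) (x : 'rV[R]_d),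
    differentiable
      (foldr (fun (v : 'rV[R]_d) (g : vfield R d) => fun y => 'd g y v) f vs) x.

Definition lie_bracket (R : realType) (d : nat) (f g : vfield R d) :
    vfield R d :=
  fun x => 'd g x (f x) - 'd f x (g x).

(* [time_one_flow g x y] means that e^g x is defined and equal to y. A vector
   field need not be complete, hence a relation. The two-sided derivatives at 0
   and 1 are harmless: a solution on [0, 1] extends affinely beyond both ends. *)
Definition time_one_flow (R : realType) (d : nat) (g : vfield R d)
    (x y : 'rV[R]_d) : Prop :=
  exists phi : R -> 'rV[R]_d,
    [/\ phi 0 = x, phi 1 = y &
        forall t : R, 0 <= t <= 1 -> is_derive t 1 phi (g (phi t))].

Record splitting (R : realType) : Type := Splitting {
  steps : nat;
  alpha : steps.-tuple R;
  beta : steps.-tuple R;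
  steps_ge1 : (1 <= steps)%N;
  alpha_ge0 : forall i : 'I_steps, 0 <= tnth alpha i
}.

(* For s = [:: (a_1, b_1); ...; (a_k, b_k)]:
   y = e^{a_1 T f0} e^{b_1 T f1} ... e^{a_k T f0} e^{b_k T f1} x. *)
Fixpoint split_flow (R : realType) (d : nat) (f0 f1 : vfield R d) (T : R)
    (s : seq (R * R)) (x y : 'rV[R]_d) : Prop :=
  if s is (a, b) :: s' then
    exists z w : 'rV[R]_d,
      [/\ split_flow f0 f1 T s' x z,
          time_one_flow (fun u => (b * T) *: f1 u) z w &
          time_one_flow (fun u => (a * T) *: f0 u) w y]
  else y = x.

Definition splitting_order (R : realType) (d : nat) (m : splitting R) (N : nat)
    (f0 f1 : vfield R d) : Prop :=
  forall x0 : 'rV[R]_d, exists C : R, \forall T \near 0^'+,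
    exists y z : 'rV[R]_d,
      [/\ time_one_flow (fun u => T *: (f0 u + f1 u)) x0 y,
          split_flow f0 f1 T (zip (alpha m) (beta m)) x0 z &
          `|y - z| <= C * T ^+ N.+1].

Definition linearly_dependent2 (R : realType) (d : nat) (f g : vfield R d) :
    Prop :=
  exists a b : R, (a != 0 \/ b != 0) /\ forall x, a *: f x + b *: g x = 0.

(* Main.v *)
Require Import Defs.
From HB Require Import structures.
From mathcomp Require Import all_boot all_order all_algebra.
From mathcomp Require Import all_classical all_reals all_analysis.
From mathcomp Require Import ring lra.

Set Implicit Arguments.
Unset Strict Implicit.
Unset Printing Implicit Defensive.

Import Order.TTheory GRing.Theory Num.Theory.
Import numFieldNormedType.Exports.

Local Open Scope classical_set_scope.
Local Open Scope ring_scope.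

(** The proof compares Taylor expansions in the step size [T]. For a smooth
observable [h], the Lie series

   h (e^{a T f} z) = sum_j (a T)^j / j! (L_f^j h)(z),   L_f h = Dh f,

holds to every order, uniformly for [z] near the starting point, so it can be
iterated along a composition of flows. Both the exact flow and the splitting
method then become series in words in [L_{f0}] and [L_{f1}], and the
coefficients up to order three must agree at every point [x] when applied to
the identity map ([split_order_series]).

The coefficients of the words are iterated sums of the [alpha_i] and [beta_i],
hence obey the shuffle relations; up to order three, only those of the words
0, 1, 01, 001 and 110 are free. Orders one and two give relations between
f0, f1 and [f1, f0] whose coefficients are c0 - 1, c1 - 1 and
c01 - 1/2. If one of these numbers is nonzero then [f1, f0] = 0 and both
double brackets vanish. Otherwise order three reads

   (c110 - 1/6) [f1, [f1, f0]] + (c001 - 1/6) [[f1, f0], f0] = 0,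

and it remains to exclude c110 = c001 = 1/6. This is where alpha >= 0
enters. Take s, the elapsed time of f0, as a clock on the unit interval, and let
B s be the total time spent so far along f1. Then

   int_0^1 (B s - s)^2 ds = 2 c110 - c0^2 c1 + 2 c001 + c0^3 / 3,

and the right-hand side is 0 for those values of the coefficients, whereas
B is a step function and cannot equal the identity. The discrete form of
this argument is [defect_split_gt0].

Recognising the Lie brackets in the third-order words needs
L_{[f, g]} = L_f L_g - L_g L_f, that is, the symmetry of second derivatives.
The latter comes from the same expansions: the translations by [T v] and
[T w], which are flows of constant fields, commute ([schwarz]). *)

(** * Smooth maps and Lie derivatives *)

Section Smooth.
Context {R : realType} {d : nat}.
Local Notation E := 'rV[R]_d.
Implicit Types (f g h u w : E -> E) (v x : E).

Definition lieD g h : E -> E := fun x => 'd h x (g x).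

Lemma diff_coord (V : normedModType R) (h : V -> E) (x v : V) i :
  differentiable h x -> 'd h x v 0 i = 'd (fun y => h y 0 i) x v.
Proof.
move=> dh.
have dc := differentiable_coord (h x) 0 i.
have @f : {linear E -> R}.
  by exists (fun N : E => N 0 i); do 2![eexists]; do ?[constructor];
     rewrite ?mxE// => ? *; rewrite ?mxE//; move=> ?; rewrite !mxE.
have -> : (fun y => h y 0 i) = f \o h by [].
rewrite [in RHS](diff_comp dh dc) /=.
by rewrite (@diff_lin _ _ _ f (h x) (@coord_continuous _ _ _ 0 i)).
Qed.

Lemma differentiable_coords (V : normedModType R) (h : V -> E) (x : V) :
  (forall i, differentiable (fun y => h y 0 i) x) -> differentiable h x.
Proof.
move=> dh; rewrite (_ : h = \sum_i fun y => h y 0 i *: delta_mx 0 i).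
  by apply: differentiable_sum => i; exact: differentiableZl.
by apply/funext => y; rewrite fct_sumE [LHS]row_sum_delta.
Qed.

Lemma differentiable_coordE h x i :
  differentiable h x -> differentiable (fun y => h y 0 i) x.
Proof.
move=> dh; rewrite (_ : (fun y => h y 0 i) = (fun M : E => M 0 i) \o h) //.
exact/differentiable_comp/differentiable_coord.
Qed.

Lemma differentiable_scale u w x i :
  differentiable u x -> differentiable w x ->
  differentiable (fun y => u y 0 i *: w y) x.
Proof.
move=> du dw; apply: differentiable_coords => j.
rewrite (_ : (fun y => _) = (fun y => u y 0 i) * (fun y => w y 0 j)); last first.
  by apply/funext => y; rewrite mxE.
by apply: differentiableM; exact: differentiable_coordE.
Qed.

Lemma diff_scale u w x v i :
  differentiable u x -> differentiable w x ->
  'd (fun y => u y 0 i *: w y) x v = 'd u x v 0 i *: w x + u x 0 i *: 'd w x v.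
Proof.
move=> du dw; apply/rowP => j.
apply: etrans (diff_coord v j (differentiable_scale i du dw)) _.
rewrite (_ : (fun y => _) = (fun y => u y 0 i) * (fun y => w y 0 j)); last first.
  by apply/funext => y; rewrite mxE.
rewrite (diffM (differentiable_coordE i du) (differentiable_coordE j dw)) /=.
rewrite [RHS]mxE [X in _ = X + _]mxE [X in _ = _ + X]mxE.
rewrite addrC; congr (_ + _); last by congr (_ * _); exact/esym/diff_coord.
by apply: etrans (mulrC _ _) _; congr (_ * _); exact/esym/diff_coord.
Qed.

(** Smoothness graded by the number of derivatives, so that closure under
products can be proved by induction: differentiating a product once gives a
sum of two products, each having one derivative less to spare. *)
Fixpoint diff_upto n h : Prop :=
  if n is n'.+1 then (forall x, differentiable h x) /\
    forall v, diff_upto n' (fun y => 'd h y v)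
  else True.

Lemma smooth_diff_upto h n : smooth h -> diff_upto n h.
Proof.
move=> sh; suff: forall vs, diff_upto n (foldr
  (fun (v : E) (g : vfield R d) => fun y => 'd g y v) h vs) by move/(_ [::]).
elim: n => //= n IHn vs; split; first exact: sh.
by move=> v; have := IHn (v :: vs).
Qed.

Lemma diff_upto_smooth h : (forall n, diff_upto n h) -> smooth h.
Proof.
move=> sh vs; elim/last_ind: vs h sh => [|vs v IH] h sh x.
  by have [] := sh 1%N.
rewrite foldr_rcons; apply: IH => n.
by have [_] := sh n.+1; apply.
Qed.

Lemma diff_add u w x v : differentiable u x -> differentiable w x ->
  'd (fun y => u y + w y) x v = 'd u x v + 'd w x v.
Proof.
by move=> du dw; have /(congr1 (@^~ v)) := diffD du dw.
Qed.

Lemma diff_uptoD n u w :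
  diff_upto n u -> diff_upto n w -> diff_upto n (fun y => u y + w y).
Proof.
elim: n u w => [//|n IHn] u w [du su] [dw sw]; split.
  by move=> x; exact: (differentiableD (du x) (dw x)).
move=> v; rewrite (_ : (fun y => _) = (fun y => 'd u y v + 'd w y v)).
  exact: IHn (su v) (sw v).
by apply/funext => y; exact: diff_add.
Qed.

Lemma diff_upto_cst n (c : E) : diff_upto n (fun=> c).
Proof.
elim: n c => [//|n IHn] c; split; first by move=> x; exact: differentiable_cst.
move=> v; rewrite (_ : (fun y => _) = (fun=> 0)); first exact: (IHn 0).
by apply/funext => y; have /(congr1 (@^~ v)) := @diff_cst _ E E c y.
Qed.

Lemma diff_upto_sum (I : Type) (r : seq I) n (F : I -> E -> E) :
  (forall i, diff_upto n (F i)) -> diff_upto n (fun y => \sum_(i <- r) F i y).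
Proof.
move=> sF; elim: r => [|i r IH].
  under eq_fun do rewrite big_nil; exact: diff_upto_cst.
by under eq_fun do rewrite big_cons; exact: diff_uptoD.
Qed.

Lemma diff_upto_scale n u w i :
  diff_upto n u -> diff_upto n w -> diff_upto n (fun y => u y 0 i *: w y).
Proof.
have wk m f : diff_upto m.+1 f -> diff_upto m f.
  elim: m f => //= m IHm f [df sf]; split=> // v.
  by apply: IHm; exact: sf.
elim: n u w => [//|n IHn] u w su sw.
have [du Du] := su; have [dw Dw] := sw.
split; first by move=> x; exact: differentiable_scale (du x) (dw x).
move=> v; rewrite (_ : (fun y => _) =
  (fun y => 'd u y v 0 i *: w y + u y 0 i *: 'd w y v)); last first.
  by apply/funext => y; exact: diff_scale (du y) (dw y).
apply: diff_uptoD; apply: IHn; [exact: Du|exact: wk|exact: wk|exact: Dw].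
Qed.

Lemma smooth_differentiable h x : smooth h -> differentiable h x.
Proof. by move=> /(_ [::]); exact. Qed.

Lemma smooth_continuous h : smooth h -> continuous h.
Proof.
by move=> sh x; apply: differentiable_continuous; exact: smooth_differentiable.
Qed.

Lemma smooth_dir h v : smooth h -> smooth (fun y => 'd h y v).
Proof.
move=> sh; apply: diff_upto_smooth => n.
by have [_] := smooth_diff_upto n.+1 sh; apply.
Qed.

Lemma smooth_scale u h i :
  smooth u -> smooth h -> smooth (fun y => u y 0 i *: h y : E).
Proof.
by move=> su sh; apply: diff_upto_smooth => n; apply: diff_upto_scale;
  exact: smooth_diff_upto.
Qed.

(** Smoothness speaks of derivatives in constant directions, and this formula
reduces the varying direction [g y] to those. *)
Lemma lieD_coord g h :
  lieD g h = (fun y => \sum_i g y 0 i *: 'd h y (delta_mx 0 i)).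
Proof.
apply/funext => y; rewrite /lieD {1}[g y]row_sum_delta linear_sum.
by apply: eq_bigr => i _; rewrite linearZ.
Qed.

Lemma smooth_lieD g h : smooth g -> smooth h -> smooth (lieD g h).
Proof.
move=> sg sh; apply: diff_upto_smooth => n; rewrite lieD_coord.
apply: diff_upto_sum => i; apply: diff_upto_scale; apply: smooth_diff_upto => //.
exact: smooth_dir.
Qed.

Lemma smoothD u w : smooth u -> smooth w -> smooth (fun y => u y + w y).
Proof.
by move=> su sw; apply: diff_upto_smooth => n; apply: diff_uptoD;
  exact: smooth_diff_upto.
Qed.

Lemma smoothN h : smooth h -> smooth (fun y => - h y).
Proof.
move=> sh; suff H n (g : E -> E) : diff_upto n g -> diff_upto n (fun y => - g y).
  by apply: diff_upto_smooth => n; apply: H; exact: smooth_diff_upto.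
elim: n g => [//|n IHn] g [dg sg]; split.
  by move=> x; exact: differentiableN (dg x).
move=> v; rewrite (_ : (fun y => _) = (fun y => - 'd g y v)).
  exact: IHn (sg v).
by apply/funext => y; have /(congr1 (@^~ v)) := diffN (dg y).
Qed.

Lemma smooth_cst c : smooth (fun=> c : E).
Proof. by apply: diff_upto_smooth => n; exact: diff_upto_cst. Qed.

Lemma diff_idE x v : 'd (id : E -> E) x v = v.
Proof. by rewrite diff_val. Qed.

Lemma smooth_id : smooth (id : E -> E).
Proof.
apply: diff_upto_smooth => -[|n] //=; split=> // v.
rewrite (_ : (fun y => _) = (fun=> v)); first exact: diff_upto_cst.
by apply/funext => y; rewrite diff_idE.
Qed.

Lemma lieD_id g : lieD g id = g.
Proof. by apply/funext => y; rewrite /lieD diff_idE. Qed.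

Lemma lieDDr g u w : smooth u -> smooth w ->
  lieD g (fun y => u y + w y) = (fun y => lieD g u y + lieD g w y).
Proof.
move=> su sw; apply/funext => y; rewrite /lieD.
exact: diff_add (smooth_differentiable y su) (smooth_differentiable y sw).
Qed.

Lemma lieDBr f g h : smooth g -> smooth h ->
  lieD f (fun y => g y - h y) = (fun y => lieD f g y - lieD f h y).
Proof.
move=> sg sh; rewrite (lieDDr f sg (smoothN sh)); apply/funext => x.
congr (_ + _); have dh := smooth_differentiable x sh.
by have /(congr1 (@^~ (f x))) := diffN dh.
Qed.

Lemma lieDDl f g h :
  lieD (fun y => f y + g y) h = (fun y => lieD f h y + lieD g h y).
Proof. by apply/funext => y; rewrite /lieD linearD. Qed.

Lemma diff_sum_smooth (I : Type) (r : seq I) (F : I -> E -> E) x v :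
  (forall i, smooth (F i)) ->
  'd (fun y => \sum_(i <- r) F i y) x v = \sum_(i <- r) 'd (F i) x v.
Proof.
move=> sF.
have sS s : smooth (fun y => \sum_(i <- s) F i y).
  apply: diff_upto_smooth => n; apply: diff_upto_sum => i.
  exact: smooth_diff_upto.
elim: r => [|i r IH].
  rewrite big_nil; under eq_fun do rewrite big_nil.
  by have /(congr1 (@^~ v)) := @diff_cst _ E E 0 x.
rewrite big_cons -IH; under eq_fun do rewrite big_cons.
exact: diff_add (smooth_differentiable x (sF i)) (smooth_differentiable x (sS r)).
Qed.

Lemma smooth_iter_lieD g h n : smooth g -> smooth h -> smooth (iter n (lieD g) h).
Proof. by move=> sg sh; elim: n => //= n IHn; exact: smooth_lieD. Qed.

End Smooth.

(** * Bounds along an integral curve *)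

Section Flow.
Context {R : realType} {d : nat}.
Local Notation E := 'rV[R]_d.
Implicit Types (f g h u w : E -> E) (v x z : E).

Lemma normr_coords_le v (K : R) :
  0 <= K -> (forall i, `|v 0 i| <= K) -> `|v| <= K.
Proof.
move=> K0 vK; rewrite [leLHS]/Num.Def.normr /= mx_normrE.
by apply: bigmax_le => // -[i j] _ /=; rewrite (ord1 i).
Qed.

Lemma normr_coord_le v i : `|v 0 i| <= `|v|.
Proof.
rewrite [leRHS]/Num.Def.normr /= mx_normrE.
exact: (le_bigmax _ (fun ij : 'I_1 * 'I_d => `|v ij.1 ij.2|) (0, i)).
Qed.

Lemma is_derive_coord (psi : R -> E) (t : R) (dpsi : E) i :
  is_derive t 1 psi dpsi -> is_derive t 1 (fun s => psi s 0 i) (dpsi 0 i).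
Proof.
move=> [der <-]; split; first by have /derivable_mxP := der.
by rewrite derive_mx // mxE.
Qed.

(** Coordinatewise mean value theorem, which the sup norm makes lossless. The
bound on the derivative is asked on the interval [0 <= s < t] only, so
that the lemma applies up to the first exit time of a ball. *)
Lemma mean_value_bound (psi dpsi : R -> E) (t K : R) :
  0 <= t -> (forall s : R, 0 <= s <= t -> is_derive s 1 psi (dpsi s)) ->
  (forall s, 0 <= s < t -> `|dpsi s| <= K) -> `|psi t - psi 0| <= K * t.
Proof.
rewrite le_eqVlt => /predU1P[<- _ _|t0 der bnd].
  by rewrite subrr normr0 mulr0.
have K0 : 0 <= K by apply: le_trans (bnd 0 _); rewrite ?lexx.
apply: normr_coords_le => [|i]; first by rewrite mulr_ge0 // ltW.
have deri s : s \in `]0, t[%R ->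
    is_derive s 1 (fun s => psi s 0 i) (dpsi s 0 i).
  rewrite in_itv => /andP[s0 st]; apply: is_derive_coord.
  by apply: der; rewrite !ltW.
have cont : {within `[0, t], continuous (fun s => psi s 0 i)}.
  apply: derivable_within_continuous => s; rewrite in_itv => /der.
  by move=> /(is_derive_coord i) [].
have [s] := MVT t0 deri cont.
rewrite in_itv /= subr0 => /andP[s0 st] eqi.
rewrite !mxE eqi normrM (gtr0_norm t0) ler_wpM2r ?(ltW t0) //.
by rewrite (le_trans (normr_coord_le _ _)) // bnd // (ltW s0).
Qed.

(** At the first time [m] at which the curve is at distance [rho] from its
origin, it would have travelled at speed at most [|c| M] for a time at most 1,
hence over a distance less than [rho]. *)
Lemma flow_confined g z (phi : R -> E) (c M rho : R) :
  phi 0 = z ->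
  (forall t : R, 0 <= t <= 1 -> is_derive t 1 phi (c *: g (phi t))) ->
  (forall y, `|y - z| < rho -> `|g y| <= M) -> `|c| * M < rho -> 0 < rho ->
  forall t, 0 <= t <= 1 -> `|phi t - z| < rho.
Proof.
move=> phi0 der gM cM rho0 t t01.
rewrite ltNge; apply/negP => bad.
(* times at which the curve is outside the ball; [inf S] is the first exit *)
pose S := [set s : R | 0 <= s <= 1 /\ rho <= `|phi s - z|].
have M0 : 0 <= M by apply: le_trans (gM z _); rewrite ?subrr ?normr0.
have S0 : S !=set0 by exists t.
have Slb : has_lbound S by exists 0 => s [/andP[]].
pose m := inf S.
have m0 : 0 <= m by apply: lb_le_inf => // s [/andP[]].
have mt : m <= t by apply: ge_inf.
have m01 : 0 <= m <= 1 by rewrite m0 (le_trans mt) //; case/andP: t01.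
have before s : 0 <= s -> s < m -> `|phi s - z| < rho.
  move=> s0 sm; rewrite ltNge; apply/negP => bs.
  have : m <= s.
    by apply: ge_inf => //; split => //; rewrite s0 (le_trans (ltW sm)) //;
      case/andP: m01.
  by rewrite leNgt sm.
have cont : {for m, continuous (fun s => `|phi s - z|)}.
  apply: (@continuous_comp _ _ _ (fun s => phi s - z) Num.norm).
    apply: (@continuousB _ _ _ phi (cst z)); last exact: cst_continuous.
    by apply/differentiable_continuous/derivable1_diffP; have [] := der m m01.
  exact: norm_continuous.
have atm : rho <= `|phi m - z|.
  rewrite leNgt; apply/negP => lt.
  have /(_ _ _ lt) := cvgr_lt _ cont.
  move=> /nbhs_ballP [e /= e0 He].
  have [s Ss sm] : exists2 s, S s & s < m + e.
    by apply: inf_adherent => //; split.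
  have ms : m <= s by apply: ge_inf.
  have [_] := Ss; rewrite leNgt => /negP; apply.
  apply: He; rewrite /ball /= distrC ger0_norm ?subr_ge0 //; lra.
have : `|phi m - phi 0| <= (`|c| * M) * m.
  apply: (mean_value_bound (dpsi := fun t => c *: g (phi t))) => //.
    move=> s /andP[s0 sm]; apply: der; rewrite s0 /=.
    by case/andP: m01 => _; apply: le_trans.
  by move=> s /andP[s0 sm]; rewrite normrZ ler_wpM2l // gM // before.
rewrite phi0 => le1; have := le_trans atm le1; rewrite leNgt => /negP; apply.
by apply: le_lt_trans cM; rewrite ler_piMr ?mulr_ge0 //; case/andP: m01.
Qed.

Lemma is_derive_scalel (k : R -> R) (s dk : R) v :
  is_derive s 1 k dk -> is_derive s 1 (fun r => k r *: v) (dk *: v).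
Proof.
move=> [dk1 <-]; have dk2 : differentiable k s by apply/derivable1_diffP.
have dkv := differentiableZl v dk2.
split; first by apply/derivable1_diffP.
rewrite deriveE //; have /(congr1 (@^~ 1)) -> := diffZl v dk2.
by rewrite deriveE.
Qed.

Lemma is_derive_monomial (c s : R) j :
  is_derive s 1 (fun r => (c * r) ^+ j / j`!%:R)
    (if j is j'.+1 then c * ((c * s) ^+ j' / j'`!%:R) else 0).
Proof.
case: j => [|j].
  rewrite (_ : (fun r => _) = cst 1); first exact: is_derive_cst.
  by apply/funext => r; rewrite expr0 fact0 divr1.
have lin : is_derive s 1 (fun r : R => c * r) c.
  by apply: is_derive_eq (is_deriveZ c (is_derive_id s 1)) _; exact: mulr1.
rewrite (_ : (fun r => _) = (j.+1`!%:R^-1 : R) *: ((fun r => c * r) ^+ j.+1)).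
  apply: is_derive_eq (is_deriveZ (j.+1`!%:R^-1 : R) (is_deriveX j.+1 lin)) _.
  rewrite /= /GRing.scale /=.
  rewrite factS natrM invfM.
  have jn : j.+1%:R != 0 :> R by rewrite pnatr_eq0.
  have jf : j`!%:R != 0 :> R by rewrite pnatr_eq0 -lt0n fact_gt0.
  move: (j.+1%:R : R) (j`!%:R : R) jn jf => a b a0 b0.
  by field; rewrite a0 b0.
by apply/funext => r; rewrite exprfctE /= mulrC.
Qed.

Lemma is_derive_along h (phi : R -> E) (s : R) v :
  smooth h -> is_derive s 1 phi v ->
  is_derive s 1 (fun r => h (phi r)) ('d h (phi s) v).
Proof.
move=> sh [dphi <-]; have dp : differentiable phi s by apply/derivable1_diffP.
have dh := smooth_differentiable (phi s) sh.
have dc : differentiable (h \o phi) s by exact: differentiable_comp.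
split; first by apply/derivable1_diffP.
apply: etrans (deriveE (1 : R) dc) _; rewrite (deriveE (1 : R) dp).
by have /(congr1 (@^~ 1)) := diff_comp dp dh.
Qed.

(** Along the curve, differentiating [h] amounts to replacing it by [c L_g h];
the remainder of order [n + 1] for [h] is therefore a primitive of [c] times
the remainder of order [n] for [L_g h], and starts from 0. As [t <= 1],
integrating costs no constant. *)
Lemma lie_series_remainder g (phi : R -> E) (c M : R) (P : set E) n h :
  smooth g -> smooth h ->
  (forall t : R, 0 <= t <= 1 -> is_derive t 1 phi (c *: g (phi t))) ->
  (forall t, 0 <= t <= 1 -> P (phi t)) ->
  (forall y, P y -> `|iter n (lieD g) h y| <= M) ->
  forall t, 0 <= t <= 1 ->
  `|h (phi t) - \sum_(j < n) ((c * t) ^+ j / j`!%:R) *: iter j (lieD g) h (phi 0)|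
    <= `|c| ^+ n * M.
Proof.
move=> sg sh der Pphi; elim: n h sh => [|n IHn] h sh hM t t01.
  by rewrite big_ord0 subr0 expr0 mul1r; apply: hM; exact: Pphi.
pose X j := iter j (lieD g) h (phi 0).
pose psi s := h (phi s) - \sum_(j < n.+1) ((c * s) ^+ j / j`!%:R) *: X j.
pose dpsi s := c *: (lieD g h (phi s)
   - \sum_(j < n) ((c * s) ^+ j / j`!%:R) *: X j.+1).
have psi0 : psi 0 = 0.
  rewrite /psi big_ord_recl /= big1 => [|j _].
    by rewrite mulr0 expr0 fact0 divr1 scale1r addr0 subrr.
  by rewrite mulr0 expr0n /= mul0r scale0r.
rewrite -[X in `|X|]/(psi t) -[psi t]subr0 -psi0.
have [t0 t1] := andP t01.
have dpsiP s : 0 <= s <= t -> is_derive s 1 psi (dpsi s).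
  move=> /andP[s0 st].
  have s01 : 0 <= s <= 1 by rewrite s0 (le_trans st).
  rewrite (_ : dpsi s = 'd h (phi s) (c *: g (phi s))
     - \sum_(j < n.+1) (if val j is j'.+1 then c * ((c * s) ^+ j' / j'`!%:R) else 0)
     *: X j); last first.
    rewrite linearZ /= big_ord_recl /= scale0r add0r /dpsi scalerBr.
    congr (_ - _); rewrite scaler_sumr; apply: eq_bigr => j _.
    by rewrite scalerA.
  apply: (@is_deriveB _ _ _ (fun s => h (phi s))
    (fun s => \sum_(j < n.+1) ((c * s) ^+ j / j`!%:R) *: X j)).
    by apply: is_derive_along => //; exact: der.
  rewrite (_ : (fun s => _) = \sum_(j < n.+1) fun s => ((c * s) ^+ j / j`!%:R) *: X j).
    apply: is_derive_sum => -[j jn] /=; apply: is_derive_scalel.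
    exact: is_derive_monomial.
  by apply/funext => r; rewrite fct_sumE.
have := mean_value_bound t0 dpsiP _.
move=> /(_ (`|c| ^+ n.+1 * M)) => H.
apply: le_trans (H _) _.
  move=> s /andP[s0 st]; rewrite /dpsi normrZ exprS -mulrA ler_wpM2l //.
  rewrite /X; under eq_bigr do rewrite iterSr.
  apply: IHn; first exact: smooth_lieD.
    by move=> y /hM; rewrite iterSr.
  by rewrite s0 (le_trans (ltW st)).
rewrite ler_piMr // mulr_ge0 ?exprn_ge0 //.
by apply: le_trans (hM (phi 0) _) => //; apply: Pphi; rewrite lexx ler01.
Qed.

End Flow.

(** * Expansions in the step size *)

Section Expansion.
Context {R : realType} {d : nat}.
Local Notation E := 'rV[R]_d.
Implicit Types (f g h : E -> E) (L : (E -> E) -> E -> E) (v w x y z : E).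

Lemma sum_triangle (V : nmodType) n (F : nat -> nat -> V) :
  \sum_(k < n) \sum_(j < k.+1) F j (k - j)%N
    = \sum_(j < n) \sum_(i < n - j) F j i.
Proof.
elim: n => [|n IHn]; first by rewrite !big_ord0.
rewrite big_ord_recr IHn [in LHS]big_ord_recr [in RHS]big_ord_recr /=.
rewrite addrA subnn subSnn big_ord1; congr (_ + _).
rewrite -big_split /=; apply: eq_bigr => j _.
by rewrite subSn 1?ltnW // big_ord_recr.
Qed.

Lemma locally_bounded f x : smooth f ->
  exists2 r : R, 0 < r & forall y, `|y - x| < r -> `|f y| <= `|f x| + 1.
Proof.
move=> sf; have cf : {for x, continuous (fun y => `|f y|)}.
  apply: (@continuous_comp _ _ _ f Num.norm); last exact: norm_continuous.
  exact: smooth_continuous.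
have lt1 : `|f x| < `|f x| + 1 by rewrite ltrDl.
have /(_ _ _ lt1) := cvgr_lt _ cf.
move=> /nbhs_ballP [r /= r0 Hr]; exists r => // y yx.
by apply/ltW/Hr; rewrite -ball_normE /ball_ /= distrC.
Qed.

(** Uniformity in the starting point [z] is what allows several flows to be
composed: the next flow starts from a point that depends on [T]. *)
Lemma lie_series_uniform x g h n (a : R) : smooth g -> smooth h ->
  exists C : R, exists2 e : R, 0 < e & forall T z w, 0 < T < e -> `|z - x| < e ->
    time_one_flow (fun u => (a * T) *: g u) z w ->
    `|h w - \sum_(j < n) ((a * T) ^+ j / j`!%:R) *: iter j (lieD g) h z|
      <= C * T ^+ n.
Proof.
move=> sg sh.
have [r1 r10 g1] := locally_bounded x sg.
have [r2 r20 h1] := locally_bounded x (smooth_iter_lieD n sg sh).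
pose M := `|g x| + 1; pose r := Num.min r1 r2 / 2.
have r0 : 0 < r by rewrite divr_gt0 // lt_min r10.
have rr : r + r <= r1 /\ r + r <= r2.
  by rewrite -splitr; split; rewrite ge_min lexx ?orbT.
have aM : 0 < `|a| * M + 1 by rewrite ltr_wpDl // mulr_ge0 // addr_ge0.
exists (`|a| ^+ n * (`|iter n (lieD g) h x| + 1)).
exists (Num.min r (r / (`|a| * M + 1))).
  by rewrite lt_min r0 divr_gt0.
move=> T z w /andP[T0]; rewrite !lt_min => /andP[_ Tr] /andP[zx _].
move=> [phi [phi0 phi1 der]].
have near_x y : `|y - z| < r -> `|y - x| < r + r.
  by move=> yz; rewrite -(subrKA z) (le_lt_trans (ler_normD _ _)) // ltrD.
have conf : forall t, 0 <= t <= 1 -> `|phi t - z| < r.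
  apply: (flow_confined phi0 der) (r0) => [y yz|].
    by apply: (g1 y); case: rr => rr _; apply: lt_le_trans rr; exact: near_x.
  rewrite -/M normrM (gtr0_norm T0) mulrAC mulrC.
  move: Tr; rewrite ltr_pdivlMr //; apply: le_lt_trans.
  by rewrite ler_wpM2l ?(ltW T0) // lerDl.
rewrite -phi1 -phi0.
have h2 y : `|y - z| < r ->
    `|iter n (lieD g) h y| <= `|iter n (lieD g) h x| + 1.
  by move=> yz; apply: h1; case: rr => _ rr; apply: lt_le_trans rr; exact: near_x.
have one01 : 0 <= (1 : R) <= 1 by rewrite ler01 lexx.
have := lie_series_remainder (P := fun y => `|y - z| < r) sg sh der conf h2 one01.
by rewrite mulr1 normrM exprMn (gtr0_norm T0) mulrAC.
Qed.

(** [Rel T] holds of the points reached with step size [T]; it is a relation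
because flows may fail to exist. The coefficient [A i h] of [T ^+ i] is a
functional of the observable [h], and the expansion is required at all orders
because a composition with a flow mixes all orders below the given one. *)
Definition expands (Rel : R -> E -> Prop) (A : nat -> (E -> E) -> E) : Prop :=
  forall n h, smooth h -> exists C : R, \forall T \near 0^'+,
    forall z, Rel T z -> `|h z - \sum_(i < n) T ^+ i *: A i h| <= C * T ^+ n.

Definition point_expansion x (n : nat) (h : E -> E) : E :=
  if n is 0 then h x else 0.

(** Cauchy product of an expansion [A] with the Lie series of a flow. The flow
is applied after the motion described by [A], hence its operator [L] acts
on the observable before [A] does. *)
Definition flow_expansion (a : R) (L : (E -> E) -> E -> E)
    (A : nat -> (E -> E) -> E) n h : E :=
  \sum_(j < n.+1) (a ^+ j / j`!%:R) *: A (n - j)%N (iter j L h).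

Lemma flow_expansion0 (a : R) L A h : flow_expansion a L A 0 h = A 0 h.
Proof. by rewrite /flow_expansion big_ord1 expr0 fact0 divr1 scale1r. Qed.

Lemma flow_expansion1 (a : R) L A h :
  flow_expansion a L A 1 h = A 1 h + a *: A 0 (L h).
Proof.
by rewrite /flow_expansion !big_ord_recr big_ord0 /= !factS fact0 muln1 !divr1
  expr0 expr1 scale1r add0r.
Qed.

Lemma flow_expansion2 (a : R) L A h :
  flow_expansion a L A 2 h
    = A 2 h + a *: A 1 (L h) + (a ^+ 2 / 2) *: A 0 (L (L h)).
Proof.
by rewrite /flow_expansion !big_ord_recr big_ord0 /= !factS fact0 !muln1 !divr1
  expr0 expr1 scale1r add0r.
Qed.

Lemma flow_expansion3 (a : R) L A h :
  flow_expansion a L A 3 h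
    = A 3 h + a *: A 2 (L h) + (a ^+ 2 / 2) *: A 1 (L (L h))
      + (a ^+ 3 / 6) *: A 0 (L (L (L h))).
Proof.
by rewrite /flow_expansion !big_ord_recr big_ord0 /= !factS fact0 !muln1 !divr1
  expr0 expr1 scale1r add0r.
Qed.

Lemma expandsW (Rel Rel' : R -> E -> Prop) A :
  (forall T z, Rel' T z -> Rel T z) -> expands Rel A -> expands Rel' A.
Proof.
move=> sub expA n h sh; have [C HC] := expA n h sh; exists C.
by apply: filterS HC => T HT z /sub; exact: HT.
Qed.

Lemma expands_point x : expands (fun _ z => z = x) (point_expansion x).
Proof.
move=> n h sh; exists `|h x|; near=> T => z ->.
have T0 : 0 < T by near: T; exact: nbhs_right_gt.
case: n => [|n]; first by rewrite big_ord0 subr0 expr0 mulr1.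
rewrite big_ord_recl /= big1 ?addr0 ?expr0 ?scale1r ?subrr ?normr0.
  by rewrite mulr_ge0 // exprn_ge0 // ltW.
by move=> i _; rewrite scaler0.
Unshelve. all: by end_near. Qed.

(** The Lie series of the last flow is expanded at the intermediate point [z]; its
term of degree [j] already carries [T ^+ j], so that [A] is only needed up to
order [n - j] on the observable [L_g^j h]. *)
Lemma expands_flow x (Rel : R -> E -> Prop) A (a : R) g : smooth g ->
  (forall h, A 0 h = h x) -> expands Rel A ->
  expands (fun T w => exists2 z, Rel T z &
      time_one_flow (fun u => (a * T) *: g u) z w)
    (flow_expansion a (lieD g) A).
Proof.
move=> sg A0 expA n h sh.
have [C0 [e e0 expF]] := lie_series_uniform x n a sg sh.
have [C1 near_x] := expA 1 id smooth_id.
have : forall j : 'I_n, exists C : R, \forall T \near 0^'+,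
    forall z, Rel T z -> `|iter j (lieD g) h z
      - \sum_(i < n - j) T ^+ i *: A i (iter j (lieD g) h)| <= C * T ^+ (n - j).
  by move=> j; apply: expA; exact: smooth_iter_lieD.
move=> /fin_all_exists [C HC].
exists (C0 + \sum_(j < n) `|a ^+ j / j`!%:R| * C j).
have {HC} HC : \forall T \near 0^'+, forall j : 'I_n,
    forall z, Rel T z -> `|iter j (lieD g) h z
      - \sum_(i < n - j) T ^+ i *: A i (iter j (lieD g) h)| <= C j * T ^+ (n - j).
  exact: filter_forall.
near=> T => w [z Tz flow].
have T0 : 0 < T by near: T; exact: nbhs_right_gt.
have Te : T < e by near: T; exact: nbhs_right_lt.
have TC : T < e / (`|C1| + 1).
  by near: T; apply: nbhs_right_lt; rewrite divr_gt0 // ltr_wpDl.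
have zx : `|z - x| < e.
  have : `|z - \sum_(i < 1) T ^+ i *: A i id| <= C1 * T ^+ 1.
    by move: z Tz {flow}; near: T.
  rewrite big_ord1 A0 expr0 scale1r expr1 => /le_lt_trans; apply.
  move: TC; rewrite ltr_pdivlMr ?ltr_wpDl // mulrC; apply: le_lt_trans.
  by rewrite ler_wpM2r ?(ltW T0) // (le_trans (ler_norm _)) // lerDl.
have TC2 : forall j : 'I_n,
    forall z, Rel T z -> `|iter j (lieD g) h z
      - \sum_(i < n - j) T ^+ i *: A i (iter j (lieD g) h)| <= C j * T ^+ (n - j).
  by near: T.
have -> : \sum_(i < n) T ^+ i *: flow_expansion a (lieD g) A i h
    = \sum_(j < n) ((a * T) ^+ j / j`!%:R) *:
        \sum_(i < n - j) T ^+ i *: A i (iter j (lieD g) h).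
  pose F j i := (T ^+ (j + i) * (a ^+ j / j`!%:R)) *: A i (iter j (lieD g) h).
  transitivity (\sum_(k < n) \sum_(j < k.+1) F j (k - j)%N).
    apply: eq_bigr => k _; rewrite scaler_sumr; apply: eq_bigr => j _.
    by rewrite scalerA /F subnKC // -ltnS.
  rewrite sum_triangle; apply: eq_bigr => j _; rewrite scaler_sumr.
  apply: eq_bigr => i _; rewrite scalerA /F; congr (_ *: _).
  by rewrite exprD exprMn; ring.
rewrite -(subrKA (\sum_(j < n) ((a * T) ^+ j / j`!%:R) *: iter j (lieD g) h z)).
rewrite mulrDl (le_trans (ler_normD _ _)) // lerD //.
  by apply: expF => //; rewrite T0.
rewrite -sumrB mulr_suml (le_trans (ler_norm_sum _ _ _)) // ler_sum // => j _.
rewrite -scalerBr normrZ exprMn mulrAC normrM (ger0_norm (exprn_ge0 j (ltW T0))).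
rewrite -!mulrA ler_wpM2l //.
have -> : C j * T ^+ n = T ^+ j * (C j * T ^+ (n - j)).
  by rewrite mulrCA -exprD subnKC // ltnW.
by rewrite ler_wpM2l ?exprn_ge0 ?(ltW T0) // TC2.
Unshelve. all: by end_near. Qed.

Lemma norm_le_small_eq0 v (K : R) :
  (\forall T \near 0^'+, `|v| <= K * T) -> v = 0.
Proof.
move=> vK; apply/eqP; rewrite -normr_le0; apply/ler_addgt0Pr => e e0.
rewrite add0r.
near (0 : R)^'+ => T.
have T0 : 0 < T by near: T; exact: nbhs_right_gt.
have TC : T < e / (`|K| + 1).
  by near: T; apply: nbhs_right_lt; rewrite divr_gt0 // ltr_wpDl.
have : `|v| <= K * T by near: T.
move=> /le_trans; apply; move: TC; rewrite ltr_pdivlMr ?ltr_wpDl // mulrC => TC.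
apply/ltW; apply: le_lt_trans TC.
by rewrite ler_wpM2r ?(ltW T0) // (le_trans (ler_norm _)) // lerDl.
Unshelve. all: by end_near. Qed.

(** The constant term is bounded by a multiple of [T], hence is 0; dividing by
[T] lowers the degree. *)
Lemma small_poly_coeffs0 n (A : nat -> E) (C : R) :
  (\forall T \near 0^'+, `|\sum_(i < n) T ^+ i *: A i| <= C * T ^+ n) ->
  forall i, (i < n)%N -> A i = 0.
Proof.
elim: n A => [//|n IHn] A AC.
have A00 : A 0 = 0.
  apply: (@norm_le_small_eq0 _ (`|C| + \sum_(i < n) `|A i.+1|)).
  near=> T.
  have T0 : 0 < T by near: T; exact: nbhs_right_gt.
  have T1 : T <= 1 by near: T; exact: nbhs_right_le.
  have : `|\sum_(i < n.+1) T ^+ i *: A i| <= C * T ^+ n.+1 by near: T.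
  rewrite big_ord_recl expr0 scale1r => le1.
  rewrite -[A 0](addrK (\sum_(i < n) T ^+ bump 0 i *: A (bump 0 i))).
  rewrite (le_trans (ler_normB _ _)) // mulrDl lerD //.
    rewrite (le_trans le1) // exprS mulrA.
    rewrite (le_trans (ler_norm _)) // normrM normrM (gtr0_norm T0).
    rewrite ler_piMr ?mulr_ge0 ?(ltW T0) // ger0_norm ?exprn_ge0 ?(ltW T0) //.
    by rewrite exprn_ile1 // ltW.
  rewrite mulr_suml (le_trans (ler_norm_sum _ _ _)) // ler_sum // => i _.
  rewrite normrZ mulrC ler_wpM2l // ger0_norm ?exprn_ge0 ?(ltW T0) //.
  by rewrite exprS ler_piMr ?exprn_ile1 // ltW.
move=> [//|i]; rewrite ltnS; apply: (IHn (fun i => A i.+1)).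
near=> T.
have T0 : 0 < T by near: T; exact: nbhs_right_gt.
have : `|\sum_(i < n.+1) T ^+ i *: A i| <= C * T ^+ n.+1 by near: T.
rewrite big_ord_recl A00 scaler0 add0r.
under eq_bigr do rewrite exprS -scalerA.
by rewrite -scaler_sumr normrZ (gtr0_norm T0) exprS mulrCA ler_pM2l.
Unshelve. all: by end_near. Qed.

Lemma expands_coeffs_eq (Rel Rel' : R -> E -> Prop) A A' n h (C : R) :
  smooth h -> expands Rel A -> expands Rel' A' ->
  (\forall T \near 0^'+, exists y z,
    [/\ Rel T y, Rel' T z & `|h y - h z| <= C * T ^+ n]) ->
  forall i, (i < n)%N -> A i h = A' i h.
Proof.
move=> sh expA expA' close i lt_in.
have [C1 HC1] := expA n h sh; have [C2 HC2] := expA' n h sh.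
apply/eqP; rewrite -subr_eq0; apply/eqP; move: i lt_in.
apply: (@small_poly_coeffs0 n (fun i => A i h - A' i h) (C1 + C + C2)).
near=> T.
have [y [z [Ty Tz yz]]] : exists y z,
    [/\ Rel T y, Rel' T z & `|h y - h z| <= C * T ^+ n] by near: T.
have le1 : `|h y - \sum_(i < n) T ^+ i *: A i h| <= C1 * T ^+ n.
  by move: y Ty {yz}; near: T.
have le2 : `|h z - \sum_(i < n) T ^+ i *: A' i h| <= C2 * T ^+ n.
  by move: z Tz {yz}; near: T.
under eq_bigr do rewrite scalerBr.
rewrite sumrB -(subrKA (h y)) -(subrKA (h z) (h y)) addrA !mulrDl.
rewrite (le_trans (ler_normD _ _)) // lerD //.
by rewrite (le_trans (ler_normD _ _)) // lerD // distrC.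
Unshelve. all: by end_near. Qed.

End Expansion.

(** * Symmetry of second derivatives and Lie brackets *)

Section Bracket.
Context {R : realType} {d : nat}.
Local Notation E := 'rV[R]_d.
Implicit Types (f g h : E -> E) (v w x y z : E).

(** The factor [1 * T] is the one produced by [expands_flow] for [a = 1]. *)
Lemma translation_flow v z (T : R) :
  time_one_flow (fun u => (1 * T) *: (fun=> v : E) u) z (z + T *: v).
Proof.
exists (fun t => z + (t * T) *: v); split.
- by rewrite mul0r scale0r addr0.
- by rewrite mul1r.
move=> t _; have lin : is_derive t 1 (fun r : R => r * T) T.
  have := is_deriveZ T (is_derive_id t (1 : R)).
  rewrite (_ : T \*: id = fun r : R => r * T).
    by move=> H; apply: is_derive_eq H _; exact: mulr1.
  by apply/funext => r; exact: mulrC.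
have := is_deriveD (is_derive_cst z t (1 : R)) (is_derive_scalel v lin).
by rewrite add0r mul1r.
Qed.

(** The point [x + T v + T w] is reached by the flows of the constant fields
[v] and [w] in either order. The coefficients of [T ^+ 2] in the two
expansions of [h] at that point agree, and they differ by the order of the
two derivatives only. *)
Lemma schwarz h v w x : smooth h ->
  'd (fun y => 'd h y v) x w = 'd (fun y => 'd h y w) x v.
Proof.
move=> sh.
pose A u u' := flow_expansion 1 (lieD (fun=> u' : E))
  (flow_expansion 1 (lieD (fun=> u)) (point_expansion x)).
pose Rel u u' (T : R) (z : E) := z = x + T *: u + T *: u'.
have expA u u' : expands (Rel u u') (A u u').
  have expP := expands_flow 1 (smooth_cst u) (fun=> erefl) (expands_point x).
  have A0 k : flow_expansion 1 (lieD (fun=> u)) (point_expansion x) 0 k = k x.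
    exact: flow_expansion0.
  have := expands_flow 1 (smooth_cst u') A0 expP.
  apply: expandsW => T z ->; exists (x + T *: u); last exact: translation_flow.
  by exists x => //; exact: translation_flow.
have A2 u u' : A u u' 2 h = (2^-1 : R) *: lieD (fun=> u) (lieD (fun=> u) h) x
   + lieD (fun=> u) (lieD (fun=> u') h) x
   + (2^-1 : R) *: lieD (fun=> u') (lieD (fun=> u') h) x.
  rewrite /A !(flow_expansion0, flow_expansion1, flow_expansion2) /=.
  by rewrite !expr1n !div1r !scale1r !add0r.
have : A v w 2 h = A w v 2 h.
  apply: (@expands_coeffs_eq _ _ (Rel v w) (Rel w v) _ _ 3 h 0) => //.
  near=> T; exists (x + T *: v + T *: w), (x + T *: w + T *: v).
  by split=> //; rewrite addrAC subrr normr0 mul0r.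
rewrite !A2 addrAC [RHS]addrAC [X in _ = X + _]addrC => /addrI /esym.
exact.
Unshelve. all: by end_near. Qed.

(** Chain rule: the sum is the second derivative of [h], evaluated at [g x]
and [f x]. *)
Lemma lieD_lieD f g h x : smooth g -> smooth h ->
  lieD f (lieD g h) x = lieD (lieD f g) h x
    + \sum_i \sum_j (g x 0 i * f x 0 j) *:
        'd (fun y => 'd h y (delta_mx 0 i)) x (delta_mx 0 j).
Proof.
move=> sg sh.
have -> : lieD f (lieD g h) x
    = \sum_i 'd (fun y => g y 0 i *: 'd h y (delta_mx 0 i)) x (f x).
  rewrite [lieD g h]lieD_coord; apply: diff_sum_smooth => i.
  by apply: smooth_scale => //; exact: smooth_dir.
have -> := congr1 (@^~ x) (lieD_coord (lieD f g) h).
rewrite -big_split /=.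
apply: eq_bigr => i _.
have dd := smooth_differentiable x (smooth_dir (delta_mx 0 i) sh).
apply: etrans (diff_scale (f x) i (smooth_differentiable x sg) dd) _.
congr (_ + _).
transitivity (g x 0 i *: lieD f (fun y => 'd h y (delta_mx 0 i)) x); first by [].
rewrite [lieD f _]lieD_coord scaler_sumr; apply: eq_bigr => j _.
by rewrite scalerA.
Qed.

(** The second derivatives of [h] cancel by symmetry. *)
Lemma lieD_bracket f g h : smooth f -> smooth g -> smooth h ->
  lieD (lie_bracket f g) h = (fun x => lieD f (lieD g h) x - lieD g (lieD f h) x).
Proof.
move=> sf sg sh; apply/funext => x; rewrite !lieD_lieD //.
rewrite [X in _ = _ - (_ + X)]exchange_big /=.
under [X in _ = _ - (_ + X)]eq_bigr do under eq_bigr do rewrite mulrC schwarz //.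
by rewrite opprD addrACA subrr addr0 {1}/lieD linearB.
Qed.

Lemma lie_bracketE f g : lie_bracket f g = (fun x => lieD f g x - lieD g f x).
Proof. by []. Qed.

Lemma lie_bracketN f g x : lie_bracket f g x = - lie_bracket g f x.
Proof. by rewrite /lie_bracket opprB. Qed.

End Bracket.

(** * Words of length at most three *)

Section Coefficients.
Context {R : realType} {d : nat}.
Local Notation E := 'rV[R]_d.
Context (L0 L1 : (E -> E) -> E -> E).
Implicit Types (f g h : E -> E) (x : E).

(** Coefficients of the words 0, 1, 01, 001 and 110, where the letter [i] stands
for [L_i] and the leftmost letter is applied last to the observable, that is,
comes from the earliest flow. All other coefficients up to length three follow
from these by the shuffle relations. *)
Record weights := Weights { c0 : R; c1 : R; c01 : R; c001 : R; c110 : R }.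

(** Effect on the coefficients of a flow of [f1] during a time [b], appended
after the others: [b] times the coefficient of [u] is added to that of the
word [u1], and so on. The word 110 does not end in 1, and keeps its
coefficient; the coefficient of 00 is [c0 ^+ 2 / 2]. *)
Definition kick (b : R) (c : weights) : weights :=
  Weights (c0 c) (c1 c + b) (c01 c + b * c0 c) (c001 c + b * c0 c ^+ 2 / 2) (c110 c).

Definition drift (a : R) (c : weights) : weights :=
  Weights (c0 c + a) (c1 c) (c01 c) (c001 c) (c110 c + a * c1 c ^+ 2 / 2).

(** Term of degree [n] in the series. The dependent coefficients come from
[c0 c1 = c01 + c10], [c0 c01 = 2 c001 + c010], [c0 c10 = 2 c100 + c010], and
the same relations with the letters exchanged. *)
Definition word_series x (c : weights) (n : nat) (h : E -> E) : E :=
  let: Weights a b g p q := c in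
  match n with
  | 0 => h x
  | 1 => a *: L0 h x + b *: L1 h x
  | 2 => (a ^+ 2 / 2) *: L0 (L0 h) x + g *: L0 (L1 h) x
         + (a * b - g) *: L1 (L0 h) x + (b ^+ 2 / 2) *: L1 (L1 h) x
  | 3 => (a ^+ 3 / 6) *: L0 (L0 (L0 h)) x + p *: L0 (L0 (L1 h)) x
         + (a * g - 2 * p) *: L0 (L1 (L0 h)) x
         + (a ^+ 2 * b / 2 - a * g + p) *: L1 (L0 (L0 h)) x
         + (b * g - a * b ^+ 2 / 2 + q) *: L0 (L1 (L1 h)) x
         + (a * b ^+ 2 - b * g - 2 * q) *: L1 (L0 (L1 h)) x
         + q *: L1 (L1 (L0 h)) x + (b ^+ 3 / 6) *: L1 (L1 (L1 h)) x
  | _ => 0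
  end.

Definition has_series x (A : nat -> (E -> E) -> E) (c : weights) : Prop :=
  forall n h, (n <= 3)%N -> A n h = word_series x c n h.

Lemma has_series_point x : has_series x (point_expansion x) (Weights 0 0 0 0 0).
Proof.
case=> [|[|[|[|n]]]] h //= _.
- by apply/rowP => i; rewrite !mxE; ring.
- by apply/rowP => i; rewrite !mxE; field.
- by apply/rowP => i; rewrite !mxE; field.
Qed.

Lemma has_series_kick x A c b :
  has_series x A c -> has_series x (flow_expansion b L1 A) (kick b c).
Proof.
case: c => a0 b0 g p q Ac n h n3.
have A0 k : A 0 k = k x by rewrite Ac.
have A1 k : A 1 k = a0 *: L0 k x + b0 *: L1 k x by rewrite Ac.
have A2 k := Ac 2 k isT; have A3 k := Ac 3 k isT.
rewrite /= in A2 A3.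
case: n n3 => [|[|[|[|n]]]] //= _.
- by rewrite flow_expansion0 A0.
- rewrite flow_expansion1 A0 A1.
  by apply/rowP => i; rewrite !mxE; ring.
- rewrite flow_expansion2 A0 A1 A2.
  by apply/rowP => i; rewrite !mxE; field.
- rewrite flow_expansion3 A0 A1 A2 A3.
  by apply/rowP => i; rewrite !mxE; field.
Qed.

Lemma has_series_drift x A c b :
  has_series x A c -> has_series x (flow_expansion b L0 A) (drift b c).
Proof.
case: c => a0 b0 g p q Ac n h n3.
have A0 k : A 0 k = k x by rewrite Ac.
have A1 k : A 1 k = a0 *: L0 k x + b0 *: L1 k x by rewrite Ac.
have A2 k := Ac 2 k isT; have A3 k := Ac 3 k isT.
rewrite /= in A2 A3.
case: n n3 => [|[|[|[|n]]]] //= _.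
- by rewrite flow_expansion0 A0.
- rewrite flow_expansion1 A0 A1.
  by apply/rowP => i; rewrite !mxE; ring.
- rewrite flow_expansion2 A0 A1 A2.
  by apply/rowP => i; rewrite !mxE; field.
- rewrite flow_expansion3 A0 A1 A2 A3.
  by apply/rowP => i; rewrite !mxE; field.
Qed.

(** The series of [L0 + L1] is its exponential, in which every word of length
[n] has coefficient [1 / n!]. The operators need to be additive on the class
[S] only, as a Lie derivative is on smooth maps. *)
Lemma has_series_sum (S : (E -> E) -> Prop) L x h :
  (forall g h, S g -> S h -> S (fun y => g y + h y)) ->
  (forall h, S h -> S (L0 h)) -> (forall h, S h -> S (L1 h)) ->
  (forall g h, S g -> S h -> L0 (fun y => g y + h y) = (fun y => L0 g y + L0 h y)) ->
  (forall g h, S g -> S h -> L1 (fun y => g y + h y) = (fun y => L1 g y + L1 h y)) ->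
  (forall h, L h = (fun y => L0 h y + L1 h y)) -> S h ->
  forall n, (n <= 3)%N ->
    flow_expansion 1 L (point_expansion x) n h
    = word_series x (Weights 1 1 (1 / 2) (1 / 6) (1 / 6)) n h.
Proof.
move=> SD S0 S1 L0D L1D LE sh.
have LL : L (L h) = (fun y => (L0 (L0 h) y + L0 (L1 h) y) + (L1 (L0 h) y + L1 (L1 h) y)).
  by rewrite !LE L0D ?L1D; auto.
have LLL : L (L (L h)) = (fun y =>
    ((L0 (L0 (L0 h)) y + L0 (L0 (L1 h)) y) + (L0 (L1 (L0 h)) y + L0 (L1 (L1 h)) y))
    + ((L1 (L0 (L0 h)) y + L1 (L0 (L1 h)) y) + (L1 (L1 (L0 h)) y + L1 (L1 (L1 h)) y))).
  by rewrite LL LE !L0D ?L1D; auto; apply: SD; auto.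
case=> [|[|[|[|n]]]] // _.
- by rewrite flow_expansion0.
- by rewrite flow_expansion1 /= LE add0r !scale1r.
- rewrite flow_expansion2 /= LL.
  by apply/rowP => i; rewrite !mxE; field.
- rewrite flow_expansion3 /= LLL.
  by apply/rowP => i; rewrite !mxE; field.
Qed.

(** With [c0] as a clock [s] and [B s] the value of [c1] at that time, this is
the integral from 0 to [c0] of [(B s - s) ^+ 2]: the integral of [B ^+ 2] is
[2 c110], that of [s * B s] is [c010 + c100 = c0 ^+ 2 * c1 / 2 - c001]. *)
Definition defect (c : weights) : R :=
  2 * c110 c - c0 c ^+ 2 * c1 c + 2 * c001 c + c0 c ^+ 3 / 3.

Lemma defect_kick b c : defect (kick b c) = defect c.
Proof. by rewrite /defect /=; field. Qed.

(** During a drift [B] is constant, equal to [c1], and the integral of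
[(c1 - s) ^+ 2] over an interval of length [a] is [a] times the squared
deviation at the midpoint plus the variance [a ^+ 2 / 12]. *)
Lemma defect_drift a c :
  defect (drift a c) = defect c + a * ((c1 c - c0 c - a / 2) ^+ 2 + a ^+ 2 / 12).
Proof. by rewrite /defect /=; field. Qed.

Definition split_weights (s : seq (R * R)) : weights :=
  foldr (fun ab c => drift ab.1 (kick ab.2 c)) (Weights 0 0 0 0 0) s.

(** Each drift of length [a >= 0] contributes at least [a ^+ 3 / 12] to the
defect, so that a zero defect forces all of them to be trivial. *)
Lemma defect_split_gt0 s : (forall ab, ab \in s -> 0 <= ab.1) ->
  0 <= defect (split_weights s) /\
  (defect (split_weights s) = 0 -> c0 (split_weights s) = 0).
Proof.
elim: s => [|[a b] s IHs] pos.
  by rewrite /defect /= ; split=> //; rewrite !(mulr0, expr0n, mul0r, addr0, subr0).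
have a0 : 0 <= a by apply: (pos (a, b)); rewrite mem_head.
have [|D0 Dz] := IHs; first by move=> ab abs; apply: pos; rewrite inE abs orbT.
rewrite /= defect_drift defect_kick.
set c := split_weights s in D0 Dz *.
set e := c1 _ - _ - _.
have sq : 0 <= e ^+ 2 by exact: sqr_ge0.
have ea : 0 <= a * (e ^+ 2 + a ^+ 2 / 12).
  by apply: mulr_ge0 => //; apply: addr_ge0 => //; apply: mulr_ge0; rewrite ?sqr_ge0.
split; first exact: addr_ge0.
move=> /eqP; rewrite paddr_eq0 // => /andP[/eqP /Dz cz].
rewrite mulf_eq0 => /orP[/eqP ->|]; first by rewrite cz addr0.
have aa : 0 <= a ^+ 2 / 12 by rewrite divr_ge0 ?sqr_ge0.
rewrite (paddr_eq0 sq aa) => /andP[_].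
by rewrite mulf_eq0 sqrf_eq0 invr_eq0 pnatr_eq0 orbF => /eqP ->; rewrite cz addr0.
Qed.

(** The third order condition, once [c0 = c1 = 1] and [c01 = 1/2]: by the
shuffle relations the six mixed words group into the expansions of two double
commutators. *)
Lemma word_series_third x p q h :
  word_series x (Weights 1 1 (1 / 2) p q) 3 h
    = word_series x (Weights 1 1 (1 / 2) (1 / 6) (1 / 6)) 3 h ->
  (q - 1 / 6) *: (L1 (L1 (L0 h)) x - 2 *: L1 (L0 (L1 h)) x + L0 (L1 (L1 h)) x)
  + (p - 1 / 6) *: (L1 (L0 (L0 h)) x - 2 *: L0 (L1 (L0 h)) x
                    + L0 (L0 (L1 h)) x) = 0.
Proof.
move=> /eqP; rewrite -subr_eq0 => /eqP <- /=.
by apply/rowP => i; rewrite !mxE; field.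
Qed.

End Coefficients.

(** * Order conditions of a splitting method *)

Section Main.
Context {R : realType} {d : nat}.
Local Notation E := 'rV[R]_d.
Context (f0 f1 : E -> E) (s0 : smooth f0) (s1 : smooth f1).

Definition split_expansion x (s : seq (R * R)) : nat -> (E -> E) -> E :=
  foldr (fun ab A => flow_expansion ab.1 (lieD f0) (flow_expansion ab.2 (lieD f1) A))
    (point_expansion x) s.

Lemma expands_split x s :
  expands (fun T y => split_flow f0 f1 T s x y) (split_expansion x s).
Proof.
have A0 s' h : split_expansion x s' 0 h = h x.
  by elim: s' => //= ab s' IH; rewrite !flow_expansion0.
elim: s => [|[a b] s IHs]; first exact: expands_point.
have B0 h : flow_expansion b (lieD f1) (split_expansion x s) 0 h = h x.
  by rewrite flow_expansion0.
have := expands_flow a s0 B0 (expands_flow b s1 (A0 s) IHs).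
by apply: expandsW => T y /= [z [w [? ? ?]]]; exists w => //; exists z.
Qed.

Lemma split_has_series x s :
  has_series (lieD f0) (lieD f1) x (split_expansion x s) (split_weights s).
Proof.
elim: s => [|ab s IHs] /=; first exact: has_series_point.
exact/has_series_drift/has_series_kick.
Qed.

Lemma split_order_series s :
  (forall x, exists C : R, \forall T \near 0^'+, exists y z : E,
      [/\ time_one_flow (fun u => T *: (f0 u + f1 u)) x y,
          split_flow f0 f1 T s x z & `|y - z| <= C * T ^+ 4]) ->
  forall x n, (n <= 3)%N ->
    word_series (lieD f0) (lieD f1) x (split_weights s) n id
    = word_series (lieD f0) (lieD f1) x (Weights 1 1 (1 / 2) (1 / 6) (1 / 6)) n id.
Proof.
move=> order x n n3; have [C HC] := order x.
rewrite -(split_has_series x s) //.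
rewrite -(has_series_sum (S := @smooth R d) (L := lieD (fun u => f0 u + f1 u))) //.
- have expF := expands_flow 1 (smoothD s0 s1) (fun=> erefl) (expands_point x).
  have expS := expands_split x s.
  apply/esym/(@expands_coeffs_eq _ _ _ _ _ _ 4 id C smooth_id expF expS) => //.
  near=> T.
  have [y [z [Fy Sz yz]]] : exists y z : E,
      [/\ time_one_flow (fun u => T *: (f0 u + f1 u)) x y,
          split_flow f0 f1 T s x z & `|y - z| <= C * T ^+ 4] by near: T.
  by exists y, z; split=> //; exists x => //; rewrite mul1r.
- by move=> *; exact: smoothD.
- by move=> *; exact: smooth_lieD.
- by move=> *; exact: smooth_lieD.
- by move=> *; exact: lieDDr.
- by move=> *; exact: lieDDr.
- by move=> *; exact: lieDDl.
- exact: smooth_id.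
Unshelve. all: by end_near. Qed.

Lemma double_brackets :
  lie_bracket f1 (lie_bracket f1 f0) = (fun x =>
    lieD f1 (lieD f1 f0) x - 2 *: lieD f1 (lieD f0 f1) x + lieD f0 (lieD f1 f1) x) /\
  lie_bracket (lie_bracket f1 f0) f0 = (fun x =>
    lieD f1 (lieD f0 f0) x - 2 *: lieD f0 (lieD f1 f0) x + lieD f0 (lieD f0 f1) x).
Proof.
have s10 : smooth (lieD f1 f0) by exact: smooth_lieD.
have s01 : smooth (lieD f0 f1) by exact: smooth_lieD.
have b10 := lie_bracketE f1 f0.
split; apply/funext => x.
- rewrite lie_bracketE lieD_bracket // b10 lieDBr //.
  move: (lieD f1 (lieD f1 f0) x) (lieD f1 (lieD f0 f1) x) (lieD f0 (lieD f1 f1) x).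
  by move=> u v w; apply/rowP => i; rewrite !mxE; ring.
- rewrite lie_bracketE lieD_bracket // b10 lieDBr //.
  move: (lieD f1 (lieD f0 f0) x) (lieD f0 (lieD f1 f0) x) (lieD f0 (lieD f0 f1) x).
  by move=> u v w; apply/rowP => i; rewrite !mxE; ring.
Qed.

(** Collinear vector fields commute: the relation is differentiated along [g],
and then used as a direction in which to differentiate [g]. *)
Lemma bracket_collinear f g (a b : R) (x : E) :
  smooth f -> smooth g -> (forall y : E, a *: f y + b *: g y = 0 :> E) ->
  a *: lie_bracket g f x = 0 :> E.
Proof.
move=> sf sg rel.
have df := smooth_differentiable x sf; have dg := smooth_differentiable x sg.
have e1 : a *: lieD g f x + b *: lieD g g x = 0 :> E.
  have /(congr1 (@^~ (g x))) /= <- := diffZ a df.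
  have /(congr1 (@^~ (g x))) /= <- := diffZ b dg.
  rewrite -(diff_add (g x) (differentiableZ a df) (differentiableZ b dg)).
  rewrite (_ : (fun y => _) = (fun=> 0)); last exact/funext.
  by have /(congr1 (@^~ (g x))) := @diff_cst _ E E 0 x.
have e2 : a *: lieD f g x + b *: lieD g g x = 0 :> E.
  by rewrite /lieD -!linearZ -linearD rel linear0.
rewrite lie_bracketE scalerBr; apply/eqP; rewrite subr_eq0; apply/eqP.
by apply: (addIr (b *: lieD g g x)); exact: etrans e1 (esym e2).
Qed.

End Main.

Theorem theorem1p15 (R : realType) (d : nat) (hd : (1 <= d)%N)
    (f0 f1 : vfield R d) (hf0 : smooth f0) (hf1 : smooth f1)
    (hsplit : exists m : splitting R, splitting_order m 3 f0 f1) :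
  linearly_dependent2
    (lie_bracket f1 (lie_bracket f1 f0))
    (lie_bracket (lie_bracket f1 f0) f0).
Proof.
have [m order] := hsplit.
have commuting : (forall x, lie_bracket f1 f0 x = 0) -> linearly_dependent2
    (lie_bracket f1 (lie_bracket f1 f0)) (lie_bracket (lie_bracket f1 f0) f0).
  (* the first double bracket vanishes, which is a dependence on its own *)
  move=> b0; exists 1, 0; split=> [|x]; first by left; exact: oner_neq0.
  have -> : lie_bracket f1 f0 = (fun=> 0) by exact/funext.
  have W0 : lie_bracket f1 (fun=> 0) x = 0.
    have cst0 : 'd (fun=> 0 : 'rV[R]_d) x (f1 x) = 0.
      by have /(congr1 (@^~ (f1 x))) := @diff_cst _ 'rV[R]_d 'rV[R]_d 0 x.
    exact: etrans (congr2 (fun u v => u - v) cst0 (linear0 ('d f1 x))) (subrr 0).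
  by rewrite W0; move: (lie_bracket _ _ x) => v; rewrite scaler0 scale0r add0r.
have ser := split_order_series hf0 hf1 order.
have [|_] := @defect_split_gt0 R (zip (alpha m) (beta m)).
  move=> ab /(map_f fst); rewrite -/(unzip1 _) unzip1_zip ?size_tuple //.
  by move=> /tnthP[i ->]; exact: alpha_ge0.
move: ser; case: (split_weights _) => a b g p q ser Dz.
have rel1 x : (a - 1) *: f0 x + (b - 1) *: f1 x = 0.
  have := ser x 1 isT; rewrite /= !lieD_id !scale1r => e.
  by rewrite !scalerBl !scale1r addrACA e -opprD subrr.
have [a1|a1] := eqVneq a 1; last first.
  apply: commuting => x; have /eqP := bracket_collinear x hf0 hf1 rel1.
  by rewrite scaler_eq0 subr_eq0 (negbTE a1) => /eqP.
have [b1|b1] := eqVneq b 1; last first.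
  apply: commuting => x.
  have rel1' y : (b - 1) *: f1 y + (a - 1) *: f0 y = 0 by rewrite addrC.
  have /eqP := bracket_collinear x hf1 hf0 rel1'.
  by rewrite scaler_eq0 subr_eq0 (negbTE b1) lie_bracketN oppr_eq0 => /eqP.
subst a b.
have rel2 x : (g - 1 / 2) *: lie_bracket f1 f0 x = 0.
  have := ser x 2 isT; rewrite /= !lieD_id lie_bracketE.
  move: (lieD f0 f0 x) (lieD f0 f1 x) (lieD f1 f0 x) (lieD f1 f1 x) => u v w z.
  move=> /rowP e; apply/rowP => i; move: (e i); rewrite !mxE; lra.
have [g1|g1] := eqVneq g (1 / 2); last first.
  apply: commuting => x; have /eqP := rel2 x.
  by rewrite scaler_eq0 subr_eq0 (negbTE g1) => /eqP.
subst g.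
have [W1E M2E] := double_brackets hf0 hf1.
exists (q - 1 / 6), (p - 1 / 6); split; last first.
  move=> x; rewrite W1E M2E; have := word_series_third (ser x 3 isT).
  by rewrite !lieD_id.
have [q1|q1] := eqVneq q (1 / 6); last by left; rewrite subr_eq0.
right; rewrite subr_eq0; apply/eqP => p1.
have : (1 : R) = 0 by apply: Dz; rewrite /defect /= q1 p1; field.
by apply/eqP; exact: oner_neq0.
Qed.
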